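(* Let $G$ be a finite group that is not nilpotent. If $\delta_{\mathcal{CD}}(G) = 5$, then $G \cong S_3$, the symmetric group on $3$ symbols.
   Context: For a finite group $G$ and a subgroup $H\leq G$, the Chermak--Delgado measure of $H$ is $m_G(H)=|H|\cdot|\mathbf{C}_G(H)|$, where $\mathbf{C}_G(H)$ is the centralizer of $H$ in $G$. Let $m^*(G)=\max_{H\leq G} m_G(H)$. The Chermak--Delgado lattice of $G$ is $\mathcal{CD}(G)=\{H\leq G : m_G(H)=m^*(G)\}$. Write $\delta_{\mathcal{CD}}(G)$ for the number of subgroups of $G$ that are not in $\mathcal{CD}(G)$. *)

(* Defs.v *)
From mathcomp Require Import all_boot all_fingroup all_solvable.

Set Implicit Arguments.
Unset Strict Implicit.
Unset Printing Implicit Defensive.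

Import GroupScope.

Section ChermakDelgado.

Variables (gT : finGroupType) (G : {group gT}).

Definition cd_measure (H : {group gT}) : nat := (#|H| * #|'C_G(H)|)%N.

Definition cd_max : nat := \max_(H in subgroups G) cd_measure H.

Definition cd_lattice : {set {group gT}} :=
  [set H in subgroups G | cd_measure H == cd_max].

Definition cd_delta : nat := #|subgroups G :\: cd_lattice|.

End ChermakDelgado.

(* Main.v *)
(** Members of the Chermak-Delgado lattice permute with their conjugates, so
    they are subnormal; in particular a non-normal Sylow [p]-subgroup [P] and
    its normalizer are not members. Counting conjugates of non-members then
    forces ['N_G(P) = P], [p < n <= 5] for [n = #|G : P|], and the existence of
    a normal abelian complement [Q] of order [n]. Every proper subgroup of [P]
    lies in [K = 'O_p(G)], whence [P] is cyclic, [#|P : K| = p] and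
    [K = 'Z(G)]. If [G] were a member, comparing its measure [n p |K|^2] with
    that of the abelian group [K Q], which is at least [n^2 |K|^2], would give
    [n <= p]. So [G] and all central subgroups are outside, among them [1] and
    [K]; since [n >= 3], this leaves [K = 1] and [n = 3], hence [#|G| = 6]. *)
Require Import Defs.
From mathcomp Require Import all_boot all_fingroup all_solvable.
From mathcomp Require Import zify.

Set Implicit Arguments.
Unset Strict Implicit.
Unset Printing Implicit Defensive.

Import GroupScope.

(** * Joins and subnormality in the Chermak-Delgado lattice *)

Section Measure.

Variables (gT : finGroupType) (G : {group gT}).
Implicit Types H K A P : {group gT}.

Lemma cd_latticeP H :
  reflect (H \subset G /\ cd_measure G H = cd_max G) (H \in cd_lattice G).
Proof. by rewrite !inE; apply: (iffP andP) => -[sHG /eqP]. Qed.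

Lemma cd_measure_gt0 H : 0 < cd_measure G H.
Proof. by rewrite muln_gt0 !cardG_gt0. Qed.

Lemma cd_measure_le H : H \subset G -> cd_measure G H <= cd_max G.
Proof. by move=> sHG; apply: leq_bigmax_cond; rewrite inE. Qed.

Lemma cd_measureJ H x : x \in G -> cd_measure G (H :^ x)%G = cd_measure G H.
Proof.
move=> Gx; rewrite /cd_measure /= centJ -{1}(conjGid Gx) -conjIg.
by rewrite !cardJg.
Qed.

Lemma cd_latticeJ H x :
  x \in G -> ((H :^ x)%G \in cd_lattice G) = (H \in cd_lattice G).
Proof. by move=> Gx; rewrite !inE cd_measureJ //= -{1}(conjGid Gx) conjSg. Qed.

(* The last factors keep track of whether [H K] is a subgroup. *)
Lemma cd_measure_mul H K :
  cd_measure G H * cd_measure G K * #|H <*> K|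
    <= cd_measure G (H :&: K)%G * cd_measure G (H <*> K)%G * #|H * K|.
Proof.
rewrite /cd_measure /= centY setIIr.
(* The only inequality used: both centralizers centralize [H :&: K]. The rest is the product
   formula, for [H], [K] and for their centralizers. *)
have: #|'C_G(H) * 'C_G(K)| <= #|'C_G(H :&: K)|.
  by rewrite subset_leq_card // mul_subG // setIS // centS ?subsetIl ?subsetIr.
have := mul_cardG 'C_G(H) 'C_G(K); have := mul_cardG H K => /=.
move: #|H * K| #|_ :&: K| #|'C_G(H) * 'C_G(K)| #|_ :&: 'C_G(K)| => a b d c.
move=> E1 E2 le_d.
rewrite mulnACA E1 E2; move: #|H <*> K| #|'C_G(_ :&: _)| le_d => j e le_d.
have -> : (a * b * (d * c) * j = a * b * c * j * d)%N by lia.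
have -> : (b * e * (j * c) * a = a * b * c * j * e)%N by lia.
exact: leq_mul.
Qed.

(** No measure exceeds [cd_max G] and [H * K] lies in the join, so the preceding inequality is
    squeezed into equalities. *)
Lemma cd_lattice_join H K :
  H \in cd_lattice G -> K \in cd_lattice G ->
  (H <*> K)%G \in cd_lattice G /\ H <*> K = H * K.
Proof.
move=> /cd_latticeP[sHG mH] /cd_latticeP[sKG mK].
have sJG: H <*> K \subset G by rewrite join_subG sHG.
have := cd_measure_mul H K; rewrite mH mK => le_m.
have le_I: cd_measure G (H :&: K)%G <= cd_max G.
  by rewrite cd_measure_le // subIset ?sHG.
have le_J := @cd_measure_le (H <*> K)%G sJG.
have sHKJ: H * K \subset H <*> K by rewrite mulG_subG joing_subl joing_subr.
have m_gt0: 0 < cd_max G by rewrite -mH cd_measure_gt0.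
have J_gt0 := cardG_gt0 (H <*> K)%G.
have le_HK := subset_leq_card sHKJ.
have mJ: cd_measure G (H <*> K)%G = cd_max G.
  apply/eqP; rewrite eqn_leq le_J.
  rewrite -(leq_pmul2l (_ : 0 < cd_max G * #|H <*> K|)) ?muln_gt0 ?m_gt0 //.
  by rewrite mulnAC (leq_trans le_m) // [leqRHS]mulnAC !leq_mul.
have oHK: #|H <*> K| <= #|H * K|.
  rewrite -(leq_pmul2l (_ : 0 < cd_max G * cd_max G)) ?muln_gt0 ?m_gt0 //.
  by rewrite (leq_trans le_m) // !leq_mul.
by split; [apply/cd_latticeP | apply/esym/eqP; rewrite eqEcard sHKJ].
Qed.

(** A largest member containing [H] and satisfying [C] absorbs its conjugates, since their join with
    it is again such a member. The predicate [C] will be being a [p]-group, then being proper. *)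
Lemma cd_lattice_normal (C : pred {group gT}) H :
    (forall A x, x \in G -> C A -> A <*> A :^ x = A * A :^ x ->
       C (A <*> A :^ x)%G) ->
  H \in cd_lattice G -> C H ->
  exists M : {group gT}, [/\ M <| G, H \subset M & C M].
Proof.
move=> clC cdH CH.
pose D M := [&& M \in cd_lattice G, C M & H \subset M].
have DH: D H by rewrite /D cdH CH subxx.
case: (@arg_maxnP _ H D (fun M => #|M|) DH) => M /and3P[cdM CM sHM] maxM.
have [sMG _] := cd_latticeP _ cdM.
exists M; split=> //; rewrite /normal sMG; apply/subsetP=> x Gx.
have [cdJ defJ] := cd_lattice_join cdM (etrans (cd_latticeJ M Gx) cdM).
have CJ := clC _ _ Gx CM defJ.
have leJ: #|M <*> M :^ x| <= #|M|.
  apply: (maxM (M <*> M :^ x)%G).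
  by rewrite /D cdJ CJ (subset_trans sHM) ?joing_subl.
rewrite inE (subset_trans (joing_subr M _)) //.
suff /eqP <- : M == M <*> M :^ x :> {set gT} by [].
by rewrite eqEcard joing_subl.
Qed.

Lemma cd_lattice_pcore p H :
  H \in cd_lattice G -> p.-group H -> H \subset 'O_p(G).
Proof.
move=> cdH pH.
have [|M [nsMG sHM pM]] := @cd_lattice_normal (fun A => p.-group A) H _ cdH pH.
  by move=> A x _ pA /= ->; rewrite pgroupM pA pgroupJ.
exact: subset_trans sHM (pcore_max pM nsMG).
Qed.

Lemma cd_lattice_proper H :
  H \in cd_lattice G -> H :!=: G ->
  exists2 M : {group gT}, M <| G /\ H \subset M & M :!=: G.
Proof.
move=> cdH neHG.
pose C A := A != G :> {set gT}.
have [|M [nsMG sHM neMG]] := @cd_lattice_normal C H _ cdH neHG.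
  move=> A x Gx neAG defJ; apply: contraNneq neAG => /= defG.
  (* [x = a b^x] means [x = b a], so [G = A A^x] forces [x] into [A]. *)
  have: x \in A * A :^ x by rewrite -defJ defG.
  case/mulsgP=> a _ Aa /imsetP[b Ab ->] def_x.
  have Ax: x \in A.
    have: a * x^-1 * b = 1 by apply: (mulIg x); rewrite mul1g {3}def_x !mulgA.
    move/(canRL (mulgK _)); rewrite mul1g => /(canRL (mulKg _)).
    by move/(congr1 invg); rewrite invgK => ->; rewrite !(groupV, groupM).
  by rewrite -defG (conjGid Ax) /joing setUid genGid.
by exists M.
Qed.

End Measure.

(** * Counting conjugates outside the lattice *)

Lemma orbit_outside_cd (gT : finGroupType) (G H : {group gT}) :
    H \subset G -> H \notin cd_lattice G ->
  orbit 'JG G H \subset subgroups G :\: cd_lattice G.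
Proof.
move=> sHG ncdH; apply/subsetP=> _ /imsetP[x Gx ->] /=.
by rewrite inE cd_latticeJ // ncdH inE /= -(conjGid Gx) conjSg.
Qed.

Lemma cd_delta_ge (gT : finGroupType) (G H : {group gT})
    (X : {set {group gT}}) :
    H \subset G -> H \notin cd_lattice G ->
    X \subset subgroups G :\: cd_lattice G -> [disjoint X & orbit 'JG G H] ->
  #|G : 'N_G(H)| + #|X| <= cd_delta G.
Proof.
move=> sHG ncdH sXB disjXH; rewrite -astab1JG -card_orbit addnC.
have [_] := leq_card_setU X (orbit 'JG G H); rewrite disjXH => /eqP<-.
by rewrite setUC subset_leq_card // subUset sXB orbit_outside_cd.
Qed.

(** * Recognition of the symmetric group of degree 3 by two involutions *)

Lemma isog_D6 (gT : finGroupType) (G : {group gT}) (x y : gT) :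
    #|G| = 6 -> x \in G -> y \in G -> #[x] = 2 -> #[y] = 2 -> x != y ->
  G \isog [set: 'D_6].
Proof.
move=> oG Gx Gy ox oy neqxy.
have sHG: <<[set x; y]>> \subset G by rewrite gen_subG subUset !sub1set Gx.
suff defG: <<[set x; y]>> = G.
  by have /= := involutions_gen_dihedral ox oy neqxy; rewrite defG oG.
apply/eqP; rewrite eqEcard sHG oG.
have Hx: x \in <<[set x; y]>> by rewrite mem_gen ?set21.
have Hy: y \in <<[set x; y]>> by rewrite mem_gen ?set22.
have /dvdnP[m oH]: 2 %| #|<<[set x; y]>>| by rewrite -ox order_dvdG.
have: #|<<[set x; y]>>| %| 6 by rewrite -oG cardSg.
(* Only [m = 1] survives: 0 and 4 do not divide 6, and [m >= 3] is the goal. Order 2 would force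
   [x = y]. *)
rewrite oH; case: m oH => [|[|[|m]]] // oH _.
have eq_gen z : z \in <<[set x; y]>> -> #[z] = 2 -> <[z]> = <<[set x; y]>>.
  by move=> Hz oz; apply/eqP; rewrite eqEcard cycle_subG Hz -orderE oz oH.
have: x \in <[y]> by rewrite (eq_gen y).
by rewrite cycle2g // !inE (negPf neqxy) orbF -order_eq1 ox.
Qed.

Lemma isog_S3 (gT : finGroupType) (G : {group gT}) (x y : gT) :
    #|G| = 6 -> x \in G -> y \in G -> #[x] = 2 -> #[y] = 2 -> x != y ->
  G \isog [set: 'S_3].
Proof.
move=> oG Gx Gy ox oy neqxy.
rewrite (isog_transl _ (isog_D6 oG Gx Gy ox oy neqxy)) isog_sym.
have o_tperm (i j : 'I_3) : i != j -> #[tperm i j] = 2.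
  move=> neqij; apply: nt_prime_order; rewrite ?expgS ?expg0 ?mulg1 ?tperm2 //.
  by apply: contraTneq neqij => tij; rewrite -odd_tperm tij odd_perm1.
apply: (@isog_D6 _ _ (tperm (inord 0) (inord 1)) (tperm (inord 0) (inord 2)));
  rewrite ?inE //.
- by rewrite cardsT card_Sn.
- by rewrite o_tperm // -val_eqE /= !inordK.
- by rewrite o_tperm // -val_eqE /= !inordK.
apply/eqP=> /permP/(_ (inord 0)); rewrite !tpermL => /(congr1 val) /=.
by rewrite !inordK.
Qed.

(** * Non-normal Sylow subgroups *)

Section NonNormalSylow.

Variables (gT : finGroupType) (G P : {group gT}) (p : nat).
Implicit Types H : {group gT}.
Hypotheses (sylP : p.-Sylow(G) P) (nnP : ~~ (P <| G)).

Let sPG : P \subset G := pHall_sub sylP.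
Let pP : p.-group P := pHall_pgroup sylP.

Lemma nonnormal_Sylow_prime : prime p.
Proof.
(* For [p] not prime, [logn p] is 0 by convention, so [P] is trivial. *)
apply: contraR nnP => p_npr; have /eqP: #|P| = 1%N.
  by rewrite (card_Hall sylP) p_part lognE (negPf p_npr).
by rewrite -trivg_card1 => /eqP->; apply: normal1.
Qed.

Let p_pr := nonnormal_Sylow_prime.

Lemma nonnormal_Sylow_index : p < #|G : 'N_G(P)|.
Proof.
have := card_Syl_mod G p_pr; rewrite (card_Syl sylP).
case: ltngtP => // [lt_np|->]; last by rewrite modnn.
rewrite modn_small // => /eqP; rewrite indexg_eq1 subsetI subxx /= => nPG.
by case/negP: nnP; rewrite /normal sPG.
Qed.

Lemma nonnormal_Sylow_notin : P \notin cd_lattice G.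
Proof.
apply: contra nnP => cdP; have sPO := cd_lattice_pcore cdP pP.
suff /eqP-> : P == 'O_p(G) :> {set gT} by apply: pcore_normal.
by rewrite eqEsubset sPO (pcore_sub_Hall sylP).
Qed.

End NonNormalSylow.

(** * Structure of a group with exactly five subgroups outside the lattice *)

Section FiveOutside.

Variables (gT : finGroupType) (G P : {group gT}) (p : nat).
Implicit Types H : {group gT}.
Hypotheses (delta5 : cd_delta G = 5) (sylP : p.-Sylow(G) P) (nnP : ~~ (P <| G)).

Let sPG : P \subset G := pHall_sub sylP.
Let pP : p.-group P := pHall_pgroup sylP.
Let p_pr : prime p := nonnormal_Sylow_prime sylP nnP.
Let lt_p_n := nonnormal_Sylow_index sylP nnP.

Lemma outside_le5 (X : {set {group gT}}) :
    {in X, forall H,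
      [/\ H \subset G, H \notin cd_lattice G & H \notin orbit 'JG G P]} ->
  #|G : 'N_G(P)| + #|X| <= 5.
Proof.
move=> outX; rewrite -delta5; apply: cd_delta_ge => //.
- exact: nonnormal_Sylow_notin sylP nnP.
- by apply/subsetP=> H /outX[sHG ncdH _]; rewrite inE ncdH inE.
- by apply/pred0P=> H /=; apply/andP=> -[/outX[_ _ /negP]].
Qed.

Lemma nonconj_index H :
    H \subset G -> H \notin cd_lattice G -> #|H| != #|P| ->
  #|G : 'N_G(P)| + #|G : 'N_G(H)| <= 5.
Proof.
move=> sHG ncdH neqHP; rewrite -[#|G : 'N_G(H)|](_ : #|orbit 'JG G H| = _).
  apply: outside_le5 => _ /imsetP[x Gx ->] /=; split.
  - by rewrite -(conjGid Gx) conjSg.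
  - by rewrite cd_latticeJ.
  - apply: contra neqHP => /imsetP[y _ /(congr1 (fun A : {group gT} => #|A|))].
    by rewrite /= !cardJg => ->.
by rewrite card_orbit astab1JG.
Qed.

Lemma Sylow_self_normalizing : 'N_G(P) = P.
Proof.
have sPN : P \subset 'N_G(P) by rewrite subsetI sPG normG.
apply/eqP; rewrite eq_sym eqEcard sPN /= leqNgt; apply/negP => ltPN.
have nPN: P <| 'N_G(P) by rewrite normalSG.
have charP: P \char 'N_G(P).
  rewrite -{1}(normal_Hall_pcore (pHall_subl sPN (subsetIl _ _) sylP) nPN).
  exact: pcore_char.
have defN: 'N_G('N_G(P)) = 'N_G(P).
  apply/eqP; rewrite eqEsubset setIS ?(char_norms charP) //.
  by rewrite subsetI subsetIl normG.
(* By the Frattini argument no proper normal subgroup contains the normalizer. Being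
   self-normalizing, it would have as many conjugates as [P], at least 3, giving 6 outside. *)
have /nonconj_index: 'N_G(P)%G \notin cd_lattice G.
  apply/negP=> /cd_lattice_proper[].
    by apply: contra nnP => /eqP <-.
  move=> M [nsMG sNM] /eqP[].
  have sylPM := pHall_subl (subset_trans sPN sNM) (normal_sub nsMG) sylP.
  by rewrite -(Frattini_arg nsMG sylPM) mulGSid.
rewrite /= defN => /(_ (subsetIl _ _)); rewrite gtn_eqF // => /(_ isT).
by have := lt_p_n; have := prime_gt1 p_pr; lia.
Qed.

(** If [H] is outside, its normalizer has index at most 5 - 3 = 2, hence is normal, and its [p]-core
    lies in that of [G]. *)
Lemma Sylow_proper_pcore H : H \proper P -> H \subset 'O_p(G).
Proof.
move=> ltHP; have sHP := proper_sub ltHP; have pH := pgroupS sHP pP.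
have sHG := subset_trans sHP sPG.
have [/cd_lattice_pcore-> // | ] := boolP (H \in cd_lattice G).
move/(nonconj_index sHG).
rewrite ltn_eqF ?proper_card // => /(_ isT).
have := lt_p_n; have := prime_gt1 p_pr => p1 ltpn le5.
have nsNG: 'N_G(H) <| G.
  have := indexg_gt0 G 'N_G(H).
  case iN: #|G : _| => [|[|[|?]]] // _; last by lia.
    move/eqP: iN; rewrite indexg_eq1 => sGN.
    by have /eqP-> : 'N_G(H) == G by rewrite eqEsubset subsetIl.
  by apply: index2_normal; rewrite ?subsetIl.
apply: subset_trans (_ : 'O_p('N_G(H)) \subset _).
  by rewrite pcore_max // normalSG.
by rewrite pcore_max ?pcore_pgroup // gFnormal_trans.
Qed.

(** Two non-normal Sylow classes for distinct primes would each have at least 3 members. *)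
Lemma other_Sylow_normal q (Q : {group gT}) :
  q != p -> q.-Sylow(G) Q -> Q <| G.
Proof.
move=> neqqp sylQ; apply/negPn/negP => nnQ.
have q_pr := nonnormal_Sylow_prime sylQ nnQ.
have /nonconj_index := nonnormal_Sylow_notin sylQ nnQ.
move/(_ (pHall_sub sylQ)); have ltq := nonnormal_Sylow_index sylQ nnQ.
have := lt_p_n; have := prime_gt1 p_pr; have := prime_gt1 q_pr => q1 p1 ltp.
have neqQP: #|Q| != #|P|.
  apply: contraNneq neqqp => eqQP.
  have [|_ p_dv_P _] := pgroup_pdiv pP.
    by apply: contraNneq nnP => ->; apply: normal1.
  have /pgroupP/(_ p p_pr) := pHall_pgroup sylQ.
  by rewrite eqQP inE eq_sym => ->.
by move/(_ neqQP); lia.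
Qed.

Lemma normal_complement :
  exists Q : {group gT},
    [/\ Q <| G, abelian Q, #|Q| = #|G : P| & coprime #|P| #|Q|].
Proof.
have p_gt1 := prime_gt1 p_pr; set n := #|G : P|.
have n_mod : n %% p = 1%N.
  by rewrite /n -Sylow_self_normalizing -(card_Syl sylP) card_Syl_mod.
(* Since 2 < [n] <= 5, [n] is a prime or the square of a prime, which makes a Sylow [q]-subgroup of
   order [n] abelian. *)
have [q [e [q_pr def_n e_gt0 e_le2]]]:
  exists q e, [/\ prime q, n = q ^ e, 0 < e & e <= 2]%N.
- have n_gt2 : 2 < n.
    by rewrite /n -Sylow_self_normalizing (leq_ltn_trans _ lt_p_n).
  have n_le5 : n <= 5.
    have := @outside_le5 set0; rewrite cards0 addn0 Sylow_self_normalizing.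
    by apply=> H; rewrite inE.
  case: {n_mod}n n_gt2 n_le5 => [|[|[|[|[|[|?]]]]]] // _ _.
  + by exists 3, 1%N.
  + by exists 2, 2.
  + by exists 5, 1%N.
have neqqp : q != p.
  apply: contra_eqN n_mod => /eqP<-.
  by rewrite def_n -(prednK e_gt0) expnS modnMr.
have [Q sylQ] := Sylow_exists q G.
have copPn : coprime #|P| n.
  by apply: pnat_coprime pP _; rewrite def_n pnatX pnatE // inE /= neqqp.
have oQ : #|Q| = n.
  rewrite (card_Hall sylQ) -(Lagrange sPG) partnM // -/n def_n.
  rewrite part_p'nat ?(pi_pnat pP) ?inE 1?eq_sym //.
  by rewrite part_pnat_id ?mul1n // pnatX pnat_id.
exists Q; split=> //; first exact: other_Sylow_normal sylQ.
  by apply: p2group_abelian (pHall_pgroup sylQ) _; rewrite oQ def_n pfactorK.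
by rewrite oQ.
Qed.

Lemma maximal_pcore : maximal 'O_p(G) P.
Proof.
have sKP : 'O_p(G) \subset P by apply: pcore_sub_Hall sylP.
have [defP | [M maxM sKM]] := maximal_exists sKP.
  by case/negP: nnP; rewrite -defP pcore_normal.
suff -> : 'O_p(G) = M by [].
apply/eqP; rewrite eqEsubset sKM Sylow_proper_pcore //.
exact: maxgroupp maxM.
Qed.

(** An element of [P] outside the [p]-core generates a subgroup that cannot be proper in [P]. *)
Lemma cyclic_Sylow : cyclic P.
Proof.
have /properP[_ [x Px notKx]] := maxgroupp maximal_pcore.
apply/cyclicP; exists x; apply/eqP; rewrite eq_sym eqEproper cycle_subG Px.
by apply: contra notKx => /Sylow_proper_pcore; rewrite /= cycle_subG.
Qed.

(** The center normalizes [P], so it lies in [P]. Conversely the [p]-core centralizes the abelian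
    [P], and it centralizes [Q] because both are normal of coprime orders; and [G = P * Q]. *)
Lemma center_pcore : 'Z(G) = 'O_p(G).
Proof.
have sKP : 'O_p(G) \subset P by apply: pcore_sub_Hall sylP.
have sZP : 'Z(G) \subset P.
  by rewrite -Sylow_self_normalizing setIS // cents_norm // centS.
apply/eqP; rewrite eqEsubset pcore_max ?center_normal ?(pgroupS sZP) //=.
have [Q [nsQG _ oQ copPQ]] := normal_complement.
have defG : P * Q = G.
  apply/eqP; rewrite eqEcard mul_subG ?(normal_sub nsQG) //=.
  by rewrite coprime_cardMg // oQ Lagrange.
have defC : 'C(P) :&: 'C(Q) = 'C(G) by rewrite -centM defG.
rewrite subsetI pcore_sub -defC subsetI.
rewrite (subset_trans sKP) ?[_ \subset 'C(P)](cyclic_abelian cyclic_Sylow) //=.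
apply/commG1P/trivgP.
rewrite -(coprime_TIg (coprimeSg sKP copPQ)) commg_subI //.
  by rewrite subsetI subxx (subset_trans (pcore_sub p G)) ?normal_norm.
by rewrite subsetI subxx (subset_trans (normal_sub nsQG)) ?gFnorm.
Qed.

Lemma group_notin_cd : G \notin cd_lattice G.
Proof.
apply/negP=> /cd_latticeP[_]; rewrite /cd_measure /= -/'Z(G) center_pcore => mG.
have [Q [nsQG abQ oQ copPQ]] := normal_complement.
have sKP : 'O_p(G) \subset P by apply: pcore_sub_Hall sylP.
have cKQ : Q \subset 'C('O_p(G)).
  by rewrite -center_pcore centsC subIset // centS ?orbT ?(normal_sub nsQG).
pose A := ('O_p(G) <*> Q)%G.
have defA : A = 'O_p(G) * Q :> {set gT} by rewrite /= cent_joinEr.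
have sAG : A \subset G by rewrite join_subG pcore_sub normal_sub.
have abA : abelian A.
  rewrite /= cent_joinEr // abelianM abQ cKQ (abelianS sKP) //.
  exact: cyclic_abelian cyclic_Sylow.
have oA : #|A| = (#|'O_p(G)| * #|G : P|)%N.
  by rewrite defA coprime_cardMg ?(coprimeSg sKP) // oQ.
have := cd_measure_le sAG; rewrite -mG /cd_measure.
(* An abelian group lies in its centralizer, so the measure of [A] is at least the square of its
   order. *)
have: #|A| <= #|'C_G(A)| by rewrite subset_leq_card // subsetI sAG.
have := lt_p_n; rewrite Sylow_self_normalizing.
have := cardG_gt0 'O_p(G); rewrite -(Lagrange sPG) -(Lagrange sKP) oA.
rewrite (p_maximal_index pP maximal_pcore).
move: #|'O_p(G)| #|G : P| #|'C_G(A)| => k n c k_gt0 ltpn le_c le_m.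
have: k * n * (k * n) <= k * p * n * k.
  by apply: leq_trans le_m; rewrite leq_mul.
have -> : (k * p * n * k = k * n * (k * p))%N by lia.
by rewrite !leq_pmul2l ?muln_gt0 ?k_gt0 ?(leq_trans _ ltpn) // leqNgt ltpn.
Qed.

(** The measure of a central subgroup is at most [#|'Z(G)| * #|G|], that of [G]. *)
Lemma central_notin_cd H : H \subset 'Z(G) -> H \notin cd_lattice G.
Proof.
move=> sHZ; apply: contra group_notin_cd => /cd_latticeP[sHG mH].
apply/cd_latticeP; split=> //; apply/eqP; rewrite eqn_leq cd_measure_le //= -mH.
by rewrite /cd_measure mulnC leq_mul ?subset_leq_card ?subsetIl.
Qed.

Lemma outside_normals_le5 (X : {set {group gT}}) :
    {in X, forall H, H <| G /\ H \notin cd_lattice G} ->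
  #|G : 'N_G(P)| + #|X| <= 5.
Proof.
move=> outX; apply: outside_le5 => H /outX[nsHG ncdH]; split=> //.
  exact: normal_sub nsHG.
apply: contra nnP; rewrite orbit_sym => /imsetP[x Gx ->].
by rewrite -(normalJ _ _ x) (conjGid Gx) in nsHG.
Qed.

Let ne1G : 1%G != G.
Proof.
apply: contraNneq nnP => /(congr1 val) /= G1; have := sPG.
by rewrite -G1 => /trivgP->; apply: normal1.
Qed.

Lemma pcore_trivial : 'O_p(G) = 1.
Proof.
(* Argument by contradiction: three normal subgroups outside would leave room for at most 2
   conjugates of [P]. *)
apply/eqP; apply: contraTT isT => ntK.
pose X := [set 1%G; 'O_p(G)%G; G].
have outX : {in X, forall H, H <| G /\ H \notin cd_lattice G}.
  move=> H /setUP[/set2P[]|/set1P] ->; split.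
  - exact: normal1.
  - exact/central_notin_cd/sub1G.
  - exact: pcore_normal.
  - by apply: central_notin_cd; rewrite center_pcore.
  - exact: normal_refl.
  - exact: group_notin_cd.
have ltKG : 'O_p(G) \proper G := proper_sub_trans (maxgroupp maximal_pcore) sPG.
have oX : #|X| = 3.
  have ne1K : 1%G != 'O_p(G)%G.
    by apply: contraNneq ntK => /(congr1 val) /= <-.
  have neGK : G != 'O_p(G)%G.
    by apply: contraTneq ltKG => /(congr1 val) /= <-; rewrite properxx.
  rewrite /X setUC cardsU1 cards2 ne1K in_set2 negb_or neGK andbT.
  by rewrite eq_sym ne1G.
have := outside_normals_le5 outX; have := lt_p_n; have := prime_gt1 p_pr.
by rewrite oX; lia.
Qed.

Lemma isog_S3_of_delta5 : G \isog [set: 'S_3].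
Proof.
have oP : #|P| = p.
  by rewrite -indexg1 -pcore_trivial (p_maximal_index pP maximal_pcore).
have p_gt1 := prime_gt1 p_pr; have lt_n := lt_p_n.
have /outside_normals_le5 :
  {in [set 1%G; G], forall H, H <| G /\ H \notin cd_lattice G}.
- move=> H /set2P[] ->; split.
  + exact: normal1.
  + exact/central_notin_cd/sub1G.
  + exact: normal_refl.
  + exact: group_notin_cd.
rewrite cards2 ne1G addn2 => le5.
(* Forced by 2 <= [p] < [n] <= 3. *)
have [p2 n3] : p = 2 /\ #|G : 'N_G(P)| = 3 by lia.
have oG : #|G| = 6.
  by rewrite -(Lagrange sPG) oP p2 -[X in #|_ : X|]Sylow_self_normalizing n3.
have /cyclicP[x defP] := cyclic_Sylow.
have ox : #[x] = 2 by rewrite orderE -defP oP p2.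
have Gx : x \in G by rewrite -cycle_subG -defP.
(* Conjugating the generator of [P] by an element not normalizing [P] yields a second involution. *)
have /subsetPn[g Gg nPg] : ~~ (G \subset 'N(P)).
  by apply: contra nnP => nPG; rewrite /normal sPG.
apply: (isog_S3 oG Gx (_ : x ^ g \in G)); rewrite ?orderJ ?groupJ //.
by apply: contraNneq nPg => eqxg; rewrite defP inE -cycleJ -eqxg.
Qed.

End FiveOutside.

(** * From non-nilpotency to Sylow subgroups *)

Lemma nonnilpotent_Sylow (gT : finGroupType) (G : {group gT}) :
  ~~ nilpotent G ->
  exists p, exists2 P : {group gT}, p.-Sylow(G) P & ~~ (P <| G).
Proof.
move=> nnilG.
have [nsSyl | ] := boolP [forall P : {group gT}, Sylow G P ==> (P <| G)].
  (* Normal Sylow subgroups lie in the Fitting subgroup, and the Sylow subgroups generate [G]. *)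
  case/negP: nnilG; rewrite (nilpotentS _ (Fitting_nil G)) //.
  rewrite -{1}(Sylow_gen G) gen_subG; apply/bigcupsP=> P sylP.
  have nsPG := implyP (forallP nsSyl P) sylP; have /SylowP[p _ {}sylP] := sylP.
  exact: Fitting_max (pgroup_nil (pHall_pgroup sylP)).
case/forallPn=> P; rewrite negb_imply => /andP[/SylowP[p _ sylP] nnP].
by exists p, P.
Qed.

Theorem theorem2 (gT : finGroupType) (G : {group gT}) :
  ~~ nilpotent G -> cd_delta G = 5 -> G \isog [set: 'S_3].
Proof.
move=> /nonnilpotent_Sylow[p [P sylP nnP]] delta5.
exact: isog_S3_of_delta5 delta5 sylP nnP.
Qed.
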